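(* Let $\mathcal{H}$ be a real Hilbert space, let $B:\mathcal{H}\rightrightarrows\mathcal{H}$ be a maximally monotone operator and let $T:\mathcal{H}\to\mathcal{H}$ be a $\beta$-cocoercive operator, with $\beta>0$, such that $\operatorname{zer}(B+T)\neq\emptyset$. Let $\gamma\in{]0,4\beta[}$ and let $(\lambda_k)_{k\in\mathbb{N}}$ be a sequence in $]0,2-\gamma/(2\beta)]$ such that $\sum_{k\in\mathbb{N}}\lambda_k\left(2-\frac{\gamma}{2\beta}-\lambda_k\right)=+\infty$. Given $x_0\in\mathcal{H}$, consider the sequences defined for $k=0,1,2,\ldots$ by $$y_k=x_k-\gamma T(x_k),\qquad x_{k+1}=x_k+\lambda_k\bigl(J_{\gamma B}(y_k)-x_k\bigr).$$ Then the following assertions hold: (i) $(x_k)_{k\in\mathbb{N}}$ converges weakly to a point $\bar{x}\in\operatorname{zer}(B+T)$, and $(T(x_k))_{k\in\mathbb{N}}$ converges strongly to $T(\bar{x})$, which is the unique dual solution, i.e., the unique $u\in\mathcal{H}$ such that $0\in -B^{-1}(-u)+T^{-1}(u)$. (ii) If either $B$ is uniformly monotone on every bounded subset of its domain, or $T$ is demiregular at every point in $\operatorname{zer}(B+T)$, then $(x_k)_{k\in\mathbb{N}}$ converges strongly to $\bar{x}\in\operatorname{zer}(B+T)$.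
   Context: $\mathcal{H}$ is a real Hilbert space with inner product $\langle\cdot,\cdot\rangle$ and norm $\|\cdot\|$; $\to$ denotes norm convergence and $\rightharpoonup$ weak convergence. A set-valued operator $B:\mathcal{H}\rightrightarrows\mathcal{H}$ assigns to each $x\in\mathcal{H}$ a subset $B(x)\subseteq\mathcal{H}$; $\operatorname{gra}B=\{(x,u):u\in B(x)\}$, $\operatorname{dom}B=\{x:B(x)\neq\emptyset\}$, $\operatorname{zer}B=\{x:0\in B(x)\}$, and the inverse is the set-valued operator given by $x\in B^{-1}(u)\iff u\in B(x)$. $B$ is monotone if $\langle x-y,u-v\rangle\geq 0$ for all $(x,u),(y,v)\in\operatorname{gra}B$, and maximally monotone if in addition no monotone operator has a graph properly containing $\operatorname{gra}B$. The resolvent is $J_{\gamma B}:=(\operatorname{Id}+\gamma B)^{-1}$, $\gamma>0$; for $B$ maximally monotone it is single-valued with domain $\mathcal{H}$. $T:\mathcal{H}\to\mathcal{H}$ is $\beta$-cocoercive if $\langle x-y,T(x)-T(y)\rangle\geq\beta\|T(x)-T(y)\|^2$ for all $x,y\in\mathcal{H}$. $B$ is uniformly monotone on every bounded subset of its domain if for every bounded $C\subseteq\operatorname{dom}B$ there is an increasing function $\phi:\mathbb{R}_+\to[0,+\infty[$ vanishing only at $0$ such that $\langle x-y,u-v\rangle\geq\phi(\|x-y\|)$ for all $(x,u),(y,v)\in\operatorname{gra}B$ with $x,y\in C$. $T$ is demiregular at $x\in\mathcal{H}$ if for all sequences $(x_k)_{k\in\mathbb{N}}$ with $x_k\rightharpoonup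 x$ and $T(x_k)\to T(x)$, we have $x_k\to x$. The dual problem (in the sense of Attouch–Théra) associated with finding $x$ such that $0\in(B+T)(x)$ is to find $u\in\mathcal{H}$ such that $0\in-B^{-1}(-u)+T^{-1}(u)$; its solutions are called dual solutions. *)

(* Defs.v *)
From mathcomp Require Import all_boot all_order all_algebra.
From mathcomp Require Import all_classical all_reals all_analysis.
Set Implicit Arguments.
Unset Strict Implicit.
Unset Printing Implicit Defensive.
Import Order.TTheory GRing.Theory Num.Theory.
Import numFieldNormedType.Exports.
Local Open Scope classical_set_scope.
Local Open Scope ring_scope.

(* A real Hilbert space is a complete normed module over the reals with a
   positive definite symmetric bilinear form [ip] inducing its norm. *)
Definition induces_norm (R : realType) (H : completeNormedModType R)
  (ip : {dot H for idfun}) : Prop :=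
  forall x : H, ip x x = `|x| ^+ 2.

Definition weakly_cvg (R : realType) (H : completeNormedModType R)
  (ip : {dot H for idfun}) (x : nat -> H) (l : H) : Prop :=
  forall h : H, ip (x k) h @[k --> \oo] --> ip l h.

Section SetValuedOperators.
Context (R : realType) (H : completeNormedModType R).
Implicit Types A B : H -> set H.

Definition op_graph B : set (H * H) := [set xu | B xu.1 xu.2].

Definition op_dom B : set H := [set x | B x !=set0].

Definition op_zer B : set H := [set x | B x 0].

Definition op_inv B : H -> set H := fun u => [set x | B x u].

Definition op_add A B : H -> set H :=
  fun x => [set u + v | u in A x & v in B x].

Definition op_scale (c : R) B : H -> set H :=
  fun x => [set c *: u | u in B x].

Definition op_fun (T : H -> H) : H -> set H := fun x => [set T x].

Definition resolvent (gamma : R) B : H -> set H :=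
  op_inv (op_add (op_fun id) (op_scale gamma B)).

(* The operator [u |-> - B^-1 (- u) + T^-1 u], whose zeros are the dual
   solutions in the sense of Attouch and Thera. *)
Definition dual_op B (T : H -> H) : H -> set H :=
  op_add (fun u => [set - x | x in op_inv B (- u)]) (op_inv (op_fun T)).

Definition monotone_op (ip : {dot H for idfun}) B : Prop :=
  forall x u y v : H, op_graph B (x, u) -> op_graph B (y, v) ->
    0 <= ip (x - y) (u - v).

Definition maximally_monotone (ip : {dot H for idfun}) B : Prop :=
  monotone_op ip B /\
  forall A, monotone_op ip A -> ~ (op_graph B `<` op_graph A).

(* [phi] is only constrained on the nonnegative reals, and "increasing" is
   understood in the wide sense (nondecreasing). *)
Definition uniformly_monotone_on_bounded (ip : {dot H for idfun}) B : Prop :=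
  forall C : set H, C `<=` op_dom B -> bounded_set C ->
  exists phi : R -> R,
    [/\ forall s t, 0 <= s -> s <= t -> phi s <= phi t,
        forall t, 0 <= t -> 0 <= phi t,
        forall t, 0 <= t -> (phi t = 0 <-> t = 0)
      & forall x u y v : H, C x -> C y ->
          op_graph B (x, u) -> op_graph B (y, v) ->
          phi `|x - y| <= ip (x - y) (u - v)].

Definition cocoercive (ip : {dot H for idfun}) (beta : R) (T : H -> H) : Prop :=
  forall x y : H, beta * `|T x - T y| ^+ 2 <= ip (x - y) (T x - T y).

Definition demiregular_at (ip : {dot H for idfun}) (T : H -> H) (z : H) : Prop :=
  forall x : nat -> H, weakly_cvg ip x z -> T (x k) @[k --> \oo] --> T z ->
    x k @[k --> \oo] --> z.

End SetValuedOperators.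

(* Main.v *)
(* Write p_k for the resolvent step and d_k = p_k - x_k. Monotonicity of B and
   cocoercivity of T give, for any two points with e = x - x', t = T x - T x'
   and f the difference of the residuals d,
     <e, f> <= - |f|^2 - gamma <f, t> - gamma beta |t|^2.
   Completing the square in t gives Fejer monotonicity with respect to
   zer (B + T) and monotonicity of |d_k|, so the divergence of
   sum lam_k (2 - gamma / (2 beta) - lam_k) forces d_k -> 0; the same inequality
   at a zero z then yields T x_k -> T z. Instead of weakly convergent
   subsequences, the proof takes weak limits along ultrafilters (through the
   Riesz representation theorem); such limits are zeros of B + T by maximality
   of B, and they all coincide by Opial's argument. *)
Require Import Defs.
From mathcomp Require Import all_boot all_order all_algebra.
From mathcomp Require Import all_classical all_reals all_analysis.
From mathcomp Require Import ring lra.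
Set Implicit Arguments.
Unset Strict Implicit.
Unset Printing Implicit Defensive.
Import Order.TTheory GRing.Theory Num.Theory.
Import numFieldNormedType.Exports.
Local Open Scope classical_set_scope.
Local Open Scope ring_scope.

(** * Limits along ultrafilters and a decay criterion for real sequences *)

(** If the preimage of a neighbourhood [V] were missing from [F], then [F] restricted to its
    complement would be proper, and an ultrafilter above it would contain both sets. *)
Lemma cvg_ultra (T : Type) (U : topologicalType) (F : set_system T)
    (f : T -> U) (l : U) : Filter F ->
  (forall G : set_system T, UltraFilter G -> F `<=` G -> f @ G --> l) ->
  f @ F --> l.
Proof.
move=> FF cvgG V Vl; apply: contrapT => nFV.
have pF : ProperFilter (within (~` (f @^-1` V)) F).
  apply: Build_ProperFilter_ex => A; rewrite /within /= => FA.
  apply: contrapT => /forallNP A0; apply: nFV.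
  by apply: filterS FA => x /= xA; apply: contrapT => /xA; apply: A0.
have [G [ultraG FG]] := ultraFilterLemma pF.
have GV : G (f @^-1` V).
  by apply: cvgG Vl => A FA; apply: FG; apply: filterS FA.
have GnV : G (~` (f @^-1` V)) by apply: FG; rewrite /within /=; exact: filterE.
by have [x []] := @filter_ex _ _ _ _ (filterI GV GnV).
Qed.

(** Compactness gives a cluster point; an ultrafilter decides every preimage, so the cluster point
    is a limit. *)
Lemma ultra_compact_cvg (T : Type) (U : topologicalType) (F : set_system T)
    (f : T -> U) (K : set U) : UltraFilter F -> compact K -> F (f @^-1` K) ->
  exists l : U, f @ F --> l.
Proof.
move=> ultraF Kc FK.
have [l [_ cl]] := Kc (f @ F) _ FK.
exists l => V Vl.
have [//|FnV] := in_ultra_setVsetC (f @^-1` V) ultraF.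
by have [u [nVu /nVu]] := cl (~` V) V FnV Vl.
Qed.

Lemma sqr_cvg0 (R : realType) (V : normedModType R) (T : Type)
    (F : set_system T) (f : T -> V) : Filter F ->
  `|f k| ^+ 2 @[k --> F] --> (0 : R) -> f k @[k --> F] --> 0.
Proof.
move=> FF /cvgr0Pnorm_lt sq0; apply/cvgr0Pnorm_lt => e e0.
have := sq0 _ (exprn_gt0 2 e0); apply: filterS => k.
by rewrite normrX normr_id ltr_sqr ?nnegrE ?normr_ge0 ?(ltW e0).
Qed.

(** If [D] stayed above some [e > 0], telescoping [E] would bound [e] times every partial sum of [a]
    by [E 0]. One value of [D] below [e] suffices since [D] is nonincreasing. *)
Lemma slow_decrease_cvg0 (R : realType) (a D E : nat -> R) :
  (forall k, 0 <= a k) -> (forall k, 0 <= D k) -> (forall k, 0 <= E k) ->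
  (forall k, D k.+1 <= D k) -> (forall k, E k.+1 <= E k - a k * D k) ->
  (\sum_(0 <= k <oo) (a k)%:E)%E = +oo%E -> D @ \oo --> (0 : R).
Proof.
move=> a0 D0 E0 Ddec Edec asum.
have Dmono : nonincreasing_seq D by exact/nonincreasing_seqP.
apply/cvgr0Pnorm_lt => e e0.
suff [N DN] : exists N, D N < e.
  exists N => // n Nn /=; rewrite ger0_norm//.
  exact: le_lt_trans (Dmono _ _ Nn) DN.
apply: contrapT => /forallNP De.
have eD k : e <= D k by rewrite leNgt; apply/negP.
have bound n : e * \sum_(0 <= k < n) a k <= E 0%N - E n.
  elim: n => [|n IH]; first by rewrite big_nil mulr0 subrr.
  rewrite big_nat_recr//= mulrDr.
  have := ler_wpM2l (a0 n) (eD n); have := Edec n; lra.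
suff : (\sum_(0 <= k <oo) (a k)%:E <= (E 0%N / e)%:E)%E by rewrite asum.
apply: lime_le; first by apply: is_cvg_nneseries => n _ _; rewrite lee_fin.
apply: nearW => n; rewrite sumEFin lee_fin ler_pdivlMr// mulrC.
by apply: le_trans (bound n) _; rewrite lerBlDr lerDl.
Qed.

(** * Inner product estimates, Riesz representation and weak limits *)

Section RealHilbert.
Context (R : realType) (H : completeNormedModType R) (ip : {dot H for idfun}).
Context (ip_norm : induces_norm ip).
Implicit Types (x y z u v h : H).

Lemma ipC x y : ip x y = ip y x.
Proof. by rewrite hermC expr0 mul1r. Qed.

Lemma ipDl x y z : ip (x + y) z = ip x z + ip y z.
Proof. exact: linearDl. Qed.
Lemma ipDr x y z : ip z (x + y) = ip z x + ip z y.
Proof. exact: linearDr. Qed.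
Lemma ipNl x z : ip (- x) z = - ip x z.
Proof. exact: linearNl. Qed.
Lemma ipNr x z : ip z (- x) = - ip z x.
Proof. exact: linearNr. Qed.
Lemma ipZl a x z : ip (a *: x) z = a * ip x z.
Proof. exact: linearZl_LR. Qed.
Lemma ipZr a x z : ip z (a *: x) = a * ip z x.
Proof. exact: linearZr_LR. Qed.

Definition ipE := (ipDl, ipDr, ipNl, ipNr, ipZl, ipZr).

Lemma cauchy_schwarz x y : `|ip x y| <= `|x| * `|y|.
Proof.
suff : `|ip x y| ^+ 2 <= (`|x| * `|y|) ^+ 2.
  by rewrite ler_sqr ?nnegrE ?mulr_ge0.
rewrite exprMn -!ip_norm real_normK ?num_real//.
have [->|x0] := eqVneq x 0.
  by rewrite (linear0l ip y) (linear0l ip 0) expr0n mul0r.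
have xx : 0 < ip x x by exact: neq0_dnorm_gt0.
(* This square equals [ip x x * (ip x x * ip y y - ip x y ^+ 2)]. *)
have : 0 <= ip (ip x x *: y - ip x y *: x) (ip x x *: y - ip x y *: x).
  by rewrite ip_norm sqr_ge0.
rewrite !ipE (ipC y x).
move=> sq; rewrite -subr_ge0 -(pmulr_rge0 _ xx).
by apply: le_trans sq _; rewrite le_eqVlt; apply/orP; left; apply/eqP; ring.
Qed.

Lemma cvg_ip (T : Type) (F : set_system T) (f : T -> H) l h : Filter F ->
  f @ F --> l -> ip (f k) h @[k --> F] --> ip l h.
Proof.
move=> FF fl; apply/cvgrPdist_lt => e e0.
have h0 : 0 < `|h| + 1 by rewrite ltr_wpDl.
have /cvgrPdist_lt/(_ _ (divr_gt0 e0 h0)) := fl; apply: filterS => k lfk.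
rewrite -ipNl -ipDl; apply: le_lt_trans (cauchy_schwarz _ _) _.
move: lfk; rewrite ltr_pdivlMr//; apply: le_lt_trans.
by rewrite ler_wpM2l// lerDl.
Qed.

Lemma cvg_ip0_bounded (T : Type) (F : set_system T) (f g : T -> H) (M : R) :
  Filter F -> f @ F --> (0 : H) -> (forall k, `|g k| <= M) ->
  ip (g k) (f k) @[k --> F] --> (0 : R).
Proof.
move=> FF /cvgr0Pnorm_lt f0 gM; apply/cvgr0Pnorm_lt => e e0.
have M0 : 0 < `|M| + 1 by rewrite ltr_wpDl.
have := f0 _ (divr_gt0 e0 M0); apply: filterS => k.
rewrite ltr_pdivlMr// mulrC => fe.
apply: le_lt_trans (cauchy_schwarz _ _) _; apply: le_lt_trans fe.
rewrite ler_wpM2r//; apply: le_trans (gM k) _.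
by rewrite (le_trans (ler_norm _))// lerDl.
Qed.

(* The representing vector is the limit of a minimizing sequence of
   [x |-> |x|^2 - 2 f x]. *)
Lemma riesz (f : H -> R) (M : R) : scalar f ->
  (forall x, `|f x| <= M * `|x|) -> exists w, forall h, f h = ip w h.
Proof.
move=> f_lin f_bnd.
have fD u v : f (u + v) = f u + f v by rewrite -[u]scale1r f_lin mul1r scale1r.
have f0 : f 0 = 0 by apply: (addIr (f 0)); rewrite -fD addr0 add0r.
have fZ a u : f (a *: u) = a * f u by rewrite -[a *: u]addr0 f_lin f0 addr0.
pose q x := `|x| ^+ 2 - 2 * f x.
pose m := inf (range q).
have q_lb : has_lbound (range q).
  exists (- M ^+ 2) => _ [x _ <-]; rewrite /q.
  have := sqr_ge0 (`|x| - M); have := ler_norm (f x); have := f_bnd x; nra.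
have q_inf : has_inf (range q) by split=> //; exists (q 0), 0.
have qm x : m <= q x by apply: ge_inf => //; exists x.
(* Parallelogram law: [|x - y|^2] is [2 q x + 2 q y] minus four times [q] at the midpoint, which is
   at least [m]. *)
have mid x y : `|x - y| ^+ 2 <= 2 * (q x - m) + 2 * (q y - m).
  have := qm (2^-1 *: (x + y)).
  by rewrite /q -!ip_norm fZ fD !ipE (ipC y x); lra.
pose e (n : nat) : R := n.+1%:R^-1.
have e_gt0 n : 0 < e n by rewrite invr_gt0.
have /choice[x qx] : forall n, exists z, q z < m + e n.
  move=> n; by have [_ [x _ <-]] := inf_adherent (e_gt0 n) q_inf; exists x.
have e0 : e @ \oo --> (0 : R) := cvg_harmonic.
have x_cvg : cvg (x @ \oo).
  apply/cauchy_cvgP; apply: cauchy_exP => d d0.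
  have d4 : 0 < d ^+ 2 / 4 by rewrite divr_gt0// exprn_gt0.
  have [N _ eN] := (cvgr0Pnorm_lt _).1 e0 _ d4.
  exists (x N); exists N => // n /= Nn; rewrite -ball_normE /=.
  rewrite -ltr_sqr ?nnegrE ?normr_ge0 ?(ltW d0)//.
  have := mid (x N) (x n).
  have := eN N (leqnn N); have := eN n Nn; rewrite /= !gtr0_norm//.
  have := qx N; have := qx n; lra.
exists (lim (x @ \oo)) => h.
have xh : ip (x n) h @[n --> \oo] --> ip (lim (x @ \oo)) h by exact: cvg_ip.
suff fh : ip (x n) h @[n --> \oo] --> f h by exact: norm_cvg_unique fh xh.
pose K := `|h| ^+ 2 + 1.
have K0 : 0 < K by rewrite ltr_wpDl// sqr_ge0.
(* Moving from [x n] by [- r *: h] changes [q] by [- 2 r c + r^2 |h|^2], and the result is still at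
   least [m]. The choice [r = c / K] nearly optimizes this; the [+ 1] in [K] covers [h = 0]. *)
have gap n : (ip (x n) h - f h) ^+ 2 <= K * e n.
  set c := ip (x n) h - f h; pose r := c / K.
  have cE : c = r * K by rewrite /r divfK// gt_eqF.
  have := qm (- r *: h + x n); have := qx n.
  rewrite /q -!ip_norm f_lin !ipE (ipC h (x n)) => q1 q2.
  suff : c ^+ 2 / K <= e n by rewrite ler_pdivrMr// mulrC.
  have -> : c ^+ 2 / K = 2 * r * c - r ^+ 2 * K.
    by rewrite cE; field; rewrite gt_eqF.
  by have := sqr_ge0 r; rewrite /K /c -ip_norm; nra.
apply/cvgrPdist_lt => d d0.
have dK : 0 < d ^+ 2 / K by rewrite divr_gt0// exprn_gt0.
have [N _ eN] := (cvgr0Pnorm_lt _).1 e0 _ dK; exists N => // n /= /eN /=.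
rewrite gtr0_norm// ltr_pdivlMr// mulrC => eK.
rewrite distrC -ltr_sqr ?nnegrE ?normr_ge0 ?(ltW d0)// real_normK ?num_real//.
exact: le_lt_trans (gap n) eK.
Qed.

(** Each [ip (x k) h] stays in a compact interval, so it converges along [F]; the limit is linear
    and bounded in [h], hence represented by a vector. One ultrafilter serves all [h] at once. *)
Lemma bounded_ultra_weak_limit (F : set_system nat) (x : nat -> H)
    (M : R) : UltraFilter F -> (forall k, `|x k| <= M) ->
  exists w, forall h, ip (x k) h @[k --> F] --> ip w h.
Proof.
move=> ultraF xM.
have ip_le k h : `|ip (x k) h| <= M * `|h|.
  by apply: le_trans (cauchy_schwarz _ _) _; rewrite ler_wpM2r.
have /choice[f f_lim] : forall h, exists l : R,
    ip (x k) h @[k --> F] --> l.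
  move=> h.
  pose K := `[- (M * `|h|), M * `|h|]%classic.
  apply: (@ultra_compact_cvg _ _ _ _ K) => //; first exact: segment_compact.
  by apply: filterE => k; rewrite /K /= in_itv /= -ler_norml.
have f_lin : scalar f.
  move=> a u v; suff auv : ip (x k) (a *: u + v) @[k --> F] --> a * f u + f v.
    exact: norm_cvg_unique (f_lim _) auv.
  have -> : (fun k => ip (x k) (a *: u + v)) =
            (fun k => a * ip (x k) u + ip (x k) v).
    by apply/funext => k; rewrite !ipE.
  by apply: cvgD => //; apply: cvgMl_tmp.
have f_bnd h : `|f h| <= M * `|h|.
  apply: (ler_cvg_to (cvg_norm (f_lim h)) (cvg_cst (M * `|h|))).
  exact: nearW.
by have [w fw] := riesz f_lin f_bnd; exists w => h; rewrite -fw.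
Qed.


(** * Resolvents, dual solutions and maximality *)

Lemma resolvent_graph (gamma : R) (B : H -> set H) y p :
  gamma != 0 -> resolvent gamma B y p -> B p (gamma^-1 *: (y - p)).
Proof.
move=> g0 [_ -> [_ [w Bw <-] <-]].
by rewrite addrC addKr scalerA mulVf// scale1r.
Qed.

Lemma op_zer_addP (B : H -> set H) (T : H -> H) z :
  op_zer (op_add B (op_fun T)) z <-> B z (- T z).
Proof.
split=> [[u Bu [_ -> /eqP]]|BTz].
  by rewrite addr_eq0 => /eqP <-.
by exists (- T z) => //; exists (T z) => //; rewrite addNr.
Qed.

(** The two summands of a dual zero are [- x] with [- u] in [B x] and [y] with [u = T y]; their sum
    vanishes, so [x = y] is a primal zero. *)
Lemma op_zer_dualP (B : H -> set H) (T : H -> H) u :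
  op_zer (dual_op B T) u <->
  exists2 z, op_zer (op_add B (op_fun T)) z & u = T z.
Proof.
split=> [[_ [x Bx <-] [y uTy /eqP]]|[z /op_zer_addP BTz ->]].
  rewrite addrC subr_eq0 => /eqP yx; exists y => //.
  by apply/op_zer_addP; rewrite {1}yx -uTy; exact: Bx.
exists (- z); first by exists z.
by exists z => //; rewrite addNr.
Qed.

(** Adjoining [(w, u)] to the graph keeps it monotone, so maximality forces the pair to be there
    already. *)
Lemma maximally_monotone_mem (B : H -> set H) w u : maximally_monotone ip B ->
  (forall a v, B a v -> 0 <= ip (w - a) (u - v)) -> B w u.
Proof.
move=> [B_mono B_max] wu.
pose A a := [set v | B a v \/ (a = w /\ v = u)].
apply: contrapT => nBwu; apply: (B_max A).
  move=> a v b s; rewrite /op_graph /A /= => -[Bav|[-> ->]] [Bbs|[-> ->]].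
  - exact: B_mono.
  - by rewrite -[a - w]opprB -[v - u]opprB ipNl ipNr opprK; exact: wu.
  - exact: wu.
  - by rewrite subrr linear0l.
split=> [[a v] Bav|AB]; first by left.
by apply: nBwu; apply: (AB (w, u)); right.
Qed.

Lemma cocoercive_lipschitz (T : H -> H) (beta : R) : 0 < beta ->
  cocoercive ip beta T -> forall x y, beta * `|T x - T y| <= `|x - y|.
Proof.
move=> b0 coco x y; have [->|t0] := eqVneq (T x - T y) 0.
  by rewrite normr0 mulr0.
have t_gt0 : 0 < `|T x - T y| by rewrite normr_gt0.
rewrite -(ler_pM2r t_gt0) -mulrA -expr2.
apply: le_trans (coco x y) _; apply: le_trans (ler_norm _) _.
exact: cauchy_schwarz.
Qed.

(** * Two-point estimates for one forward-backward step *)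

Section ForwardBackward.
Context (B : H -> set H) (T : H -> H) (beta gamma : R).
Context (B_max : maximally_monotone ip B).
Context (beta_gt0 : 0 < beta).
Context (T_coco : cocoercive ip beta T).
Context (gamma_gt0 : 0 < gamma).

(* [x + d] is the forward-backward image of [x]. *)
Definition fb_step x d := B (x + d) (- (gamma^-1 *: d) - T x).

Lemma fb_step_zero z : B z (- T z) -> fb_step z 0.
Proof. by rewrite /fb_step addr0 scaler0 oppr0 add0r. Qed.

(** Add [gamma] times the monotonicity of [B] at [x + d] and [x' + d'] to [gamma] times the
    cocoercivity of [T]: the terms pairing [x - x'] with [T x - T x'] cancel. *)
Lemma fb_step_ineq x x' d d' : fb_step x d -> fb_step x' d' ->
  gamma * beta * `|T x - T x'| ^+ 2 + `|d - d'| ^+ 2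
    + gamma * ip (d - d') (T x - T x') + ip (x - x') (d - d') <= 0.
Proof.
move=> xd xd'; have := B_max.1 _ _ _ _ xd xd'.
have -> : x + d - (x' + d') = (x - x') + (d - d') by rewrite opprD addrACA.
have -> : - (gamma^-1 *: d) - T x - (- (gamma^-1 *: d') - T x') =
    - (gamma^-1 *: (d - d')) - (T x - T x').
  by rewrite [- (_ - T x')]opprD addrACA -opprD -scalerBr -opprD.
have := T_coco x x'; rewrite -!ip_norm.
move: (x - x') (d - d') (T x - T x') => e f t; rewrite !ipE => coco.
rewrite -(pmulr_rge0 _ gamma_gt0) !mulrDr.
have cancel a : gamma * - (gamma^-1 * a) = - a.
  by field; rewrite gt_eqF.
have := ler_wpM2l (ltW gamma_gt0) coco.
rewrite !cancel; lra.
Qed.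

(** Drops the square [gamma * beta * |t + f / (2 beta)|^2], where [f = d - d'] and [t = T x - T x'].
    What remains is the cocoercivity inequality for [- d] with constant [1 - gamma / (4 * beta)]. *)
Lemma fb_step_averaged x x' d d' : fb_step x d -> fb_step x' d' ->
  2 * ip (x - x') (d - d') <= - (2 - gamma / (2 * beta)) * `|d - d'| ^+ 2.
Proof.
move=> xd xd'; have := fb_step_ineq xd xd'; rewrite -!ip_norm.
move: (x - x') (d - d') (T x - T x') => e f t.
have sq : 0 <= ip (t + (2 * beta)^-1 *: f) (t + (2 * beta)^-1 *: f).
  by rewrite ip_norm sqr_ge0.
have := mulr_ge0 (mulr_ge0 (ltW gamma_gt0) (ltW beta_gt0)) sq.
rewrite !ipE (ipC t f).
rewrite [X in 0 <= X -> _](_ : _ = gamma * beta * ip t t + gamma * ip f t +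
    gamma / (2 * beta) * ip f f / 2); last by field; rewrite gt_eqF.
lra.
Qed.

(** * Asymptotics of the relaxed iteration *)

Section Iteration.
Context (lam : nat -> R) (x d : nat -> H).
Local Notation delta := (2 - gamma / (2 * beta)).
Context (lam_range : forall k, 0 < lam k /\ lam k <= delta).
Context (lam_sum :
  (\sum_(0 <= k <oo) (lam k * (delta - lam k))%:E)%E = +oo%E).
Context (d_step : forall k, fb_step (x k) (d k)).
Context (x_next : forall k, x k.+1 = x k + lam k *: d k).

Lemma fb_fejer z k : B z (- T z) ->
  `|x k.+1 - z| ^+ 2 <=
  `|x k - z| ^+ 2 - lam k * (delta - lam k) * `|d k| ^+ 2.
Proof.
move=> /fb_step_zero /(fb_step_averaged (d_step k)); rewrite subr0.
rewrite x_next (addrAC (x k)) -!ip_norm.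
move: (x k - z) (d k) (lam_range k).1 => e f l0; rewrite !ipE (ipC f e).
move=> /(ler_wpM2l (ltW l0)); lra.
Qed.

(** For consecutive iterates the displacement is [lam k *: d k], so with [g = d k.+1 - d k] the
    averaged inequality bounds [2 * lam k * ip (d k) g] by [- delta * |g|^2]; [lam k <= delta] then
    absorbs the [|g|^2] of the expansion. *)
Lemma fb_residual_decreasing k : `|d k.+1| ^+ 2 <= `|d k| ^+ 2.
Proof.
have := fb_step_averaged (d_step k.+1) (d_step k).
rewrite x_next (addrAC (x k)) subrr add0r.
have -> : `|d k.+1| ^+ 2 = `|d k + (d k.+1 - d k)| ^+ 2 by rewrite addrC subrK.
have [l0 ld] := lam_range k.
rewrite -!ip_norm; move: (d k) (d k.+1 - d k) => f g; rewrite !ipE (ipC g f).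
have gg : 0 <= ip g g by rewrite ip_norm sqr_ge0.
move=> avg; rewrite -subr_ge0 -(pmulr_rge0 _ l0).
have := ler_wpM2r gg ld; lra.
Qed.

Lemma fb_dist_decreasing z : B z (- T z) ->
  nonincreasing_seq (fun k => `|x k - z| ^+ 2).
Proof.
move=> Bz; apply/nonincreasing_seqP => k; apply: le_trans (fb_fejer k Bz) _.
have [l0 ld] := lam_range k.
by rewrite lerBlDr lerDl mulr_ge0 ?sqr_ge0// mulr_ge0 ?subr_ge0// ltW.
Qed.

Lemma fb_dist_cvg z : B z (- T z) -> cvg (`|x k - z| ^+ 2 @[k --> \oo]).
Proof.
move=> Bz; apply: nonincreasing_is_cvgn (fb_dist_decreasing Bz) _.
by exists 0 => _ [k _ <-]; rewrite sqr_ge0.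
Qed.

Lemma fb_dist_bounded z k : B z (- T z) -> `|x k - z| <= `|x 0%N - z|.
Proof.
move=> Bz; rewrite -ler_sqr ?nnegrE//.
exact: fb_dist_decreasing Bz _ _ (leq0n k).
Qed.

Lemma fb_residual_cvg0 z : B z (- T z) -> d @ \oo --> (0 : H).
Proof.
move=> Bz; apply: sqr_cvg0.
apply: (@slow_decrease_cvg0 _ (fun k => lam k * (delta - lam k))
  (fun k => `|d k| ^+ 2) (fun k => `|x k - z| ^+ 2)) => // k.
- by have [l0 ld] := lam_range k; rewrite mulr_ge0 ?subr_ge0// ltW.
- exact: fb_residual_decreasing.
- exact: fb_fejer.
Qed.

Lemma fb_forward_cvg z : B z (- T z) -> T (x k) @[k --> \oo] --> T z.
Proof.
move=> Bz; have d0 := fb_residual_cvg0 Bz.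
apply/subr_cvg0; apply: sqr_cvg0.
have x_bnd k := fb_dist_bounded k Bz.
have T_bnd k : `|T (x k) - T z| <= `|x 0%N - z| / beta.
  rewrite ler_pdivlMr// mulrC; apply: le_trans (x_bnd k).
  exact: cocoercive_lipschitz.
(* The two-point inequality against [z], whose residual is [0], divided by [gamma * beta] after
   dropping [|d k|^2]. Both pairings join a bounded sequence with [d], which tends to [0]. *)
have ub k : 0 <= `|T (x k) - T z| ^+ 2 <=
    - (beta^-1 * ip (T (x k) - T z) (d k))
    - (gamma * beta)^-1 * ip (x k - z) (d k).
  rewrite sqr_ge0 /=.
  have := fb_step_ineq (d_step k) (fb_step_zero Bz).
  rewrite subr0 (ipC (d k)).
  have gb0 : 0 < gamma * beta by rewrite mulr_gt0.
  have := sqr_ge0 `|d k|; set p := `|d k| ^+ 2; set s := _ ^+ 2.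
  set a := ip (T _ - _) _; set b := ip (x k - _) _ => p0 ineq.
  rewrite -subr_ge0 -(pmulr_rge0 _ gb0).
  have -> : gamma * beta * (- (beta^-1 * a) - (gamma * beta)^-1 * b - s) =
      - (gamma * beta * s + gamma * a + b).
    by field; rewrite !gt_eqF.
  lra.
have lim : - (beta^-1 * ip (T (x k) - T z) (d k))
    - (gamma * beta)^-1 * ip (x k - z) (d k) @[k --> \oo] --> (0 : R).
  rewrite [X in _ --> X](_ : 0 = - (beta^-1 * 0) - (gamma * beta)^-1 * 0).
    by apply: cvgB; [apply: cvgN|]; apply: cvgMl_tmp;
      [exact: cvg_ip0_bounded d0 T_bnd|exact: cvg_ip0_bounded d0 x_bnd].
  by rewrite !mulr0 oppr0 addr0.
by apply: (squeeze_cvgr _ (cvg_cst 0) lim); apply: nearW => k; exact: ub.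
Qed.

Lemma fb_bounded z k : B z (- T z) -> `|x k| <= `|x 0%N - z| + `|z|.
Proof.
move=> Bz; rewrite -[x k](subrK z); apply: le_trans (ler_normD _ _) _.
by rewrite lerD2r; exact: fb_dist_bounded.
Qed.

Lemma fb_backward_cvg z : B z (- T z) ->
  - (gamma^-1 *: d k) - T (x k) @[k --> \oo] --> - T z.
Proof.
move=> Bz; rewrite -[X in _ --> X](_ : - (gamma^-1 *: 0) - T z = - T z).
  apply: cvgB; last exact: fb_forward_cvg.
  by apply: cvgN; apply: cvgZl_tmp; exact: fb_residual_cvg0 Bz.
by rewrite scaler0 oppr0 add0r.
Qed.

Lemma fb_backward_bounded z : B z (- T z) ->
  exists M, forall k, `|x k + d k| <= M.
Proof.
move=> Bz; have d_dec : nonincreasing_seq (fun k => `|d k| ^+ 2).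
  exact/nonincreasing_seqP/fb_residual_decreasing.
exists (`|x 0%N - z| + `|z| + `|d 0%N|) => k.
apply: le_trans (ler_normD _ _) _; apply: lerD; first exact: fb_bounded.
by rewrite -ler_sqr ?nnegrE//; exact: d_dec (leq0n k).
Qed.

Lemma fb_weak_limit_zero (F : set_system nat) z w : ProperFilter F ->
  \oo `<=` F -> B z (- T z) ->
  (forall h, ip (x k) h @[k --> F] --> ip w h) -> B w (- T w).
Proof.
move=> FF ooF Bz xw.
have TF : T (x k) @[k --> F] --> T z.
  by move=> V /(fb_forward_cvg Bz) TV; exact: ooF.
have dF : d @ F --> (0 : H) by move=> V /(fb_residual_cvg0 Bz) dV; exact: ooF.
have uF : - (gamma^-1 *: d k) - T (x k) @[k --> F] --> - T z.
  by move=> V /(fb_backward_cvg Bz) uV; exact: ooF.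
(* The pairing of [x k - w] with [T (x k) - T w] tends to [0]: [T (x k)] converges strongly and
   [x k] weakly. Cocoercivity then gives [T (x k) --> T w]. *)
have Tw : T w = T z.
  have TwF : ip (x k - w) (T (x k) - T w) @[k --> F] --> (0 : R).
    have -> : (fun k => ip (x k - w) (T (x k) - T w)) =
        (fun k => ip (x k - w) (T (x k) - T z) +
          (ip (x k) (T z - T w) - ip w (T z - T w))).
      apply/funext => k; rewrite -ipNl -ipDl -ipDr.
      by rewrite addrA subrK.
    rewrite -[X in _ --> X](addr0 (0 : R)); apply: cvgD.
      apply: (@cvg_ip0_bounded _ _ _ _ (`|x 0%N - z| + `|z| + `|w|)).
        exact/subr_cvg0.
      move=> k; apply: le_trans (ler_normB _ _) _.
      by rewrite lerD2r; exact: fb_bounded.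
    by apply/subr_cvg0; exact: xw.
  have /norm_cvg_unique : T (x k) @[k --> F] --> T w.
    apply/subr_cvg0; apply: sqr_cvg0.
    have lim : beta^-1 * ip (x k - w) (T (x k) - T w) @[k --> F] --> (0 : R).
      by rewrite -[X in _ --> X](mulr0 beta^-1); exact: cvgMl_tmp.
    apply: (squeeze_cvgr _ (cvg_cst 0) lim); apply: nearW => k.
    rewrite sqr_ge0/= mulrC ler_pdivlMr// mulrC.
    exact: T_coco.
  by apply.
(* [x k + d k] tends weakly to [w] and its image under [B] contains a sequence tending strongly to
   [- T z], so the monotonicity inequality against [(a, v)] passes to the limit. *)
rewrite Tw; apply: maximally_monotone_mem B_max _ => a v Bav.
have [M pM] := fb_backward_bounded Bz.
have lim : ip (x k + d k - a) (- (gamma^-1 *: d k) - T (x k) - v) @[k --> F]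
    --> ip (w - a) (- T z - v).
  have -> : (fun k => ip (x k + d k - a) (- (gamma^-1 *: d k) - T (x k) - v)) =
      (fun k => ip (x k + d k - a) (- (gamma^-1 *: d k) - T (x k) - - T z) +
        (ip (x k) (- T z - v) + ip (d k) (- T z - v) - ip a (- T z - v))).
    apply/funext => k; rewrite -ipNl -!ipDl -ipDr.
    by rewrite addrA subrK.
  rewrite -[X in _ --> X](_ : 0 + (ip w (- T z - v) + ip 0 (- T z - v)
      - ip a (- T z - v)) = _ :> R); last first.
    by rewrite (linear0l ip) addr0 add0r -ipNl -ipDl.
  apply: cvgD.
    apply: (@cvg_ip0_bounded _ _ _ _ (M + `|a|)); first exact/subr_cvg0.
    by move=> k; apply: le_trans (ler_normB _ _) _; rewrite lerD2r.
  apply: cvgB; last exact: cvg_cst.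
  by apply: cvgD; [exact: xw|exact: cvg_ip].
apply: (ler_cvg_to (cvg_cst 0) lim); apply: nearW => k.
exact: (B_max.1 _ _ _ _ (d_step k) Bav).
Qed.

(* Opial's argument: [|x k - w|^2 - |x k - w'|^2] converges along the whole
   sequence, so two weak cluster points [w] and [w'] must agree. *)
Lemma fb_weak_cvg z : B z (- T z) ->
  exists2 w, B w (- T w) & weakly_cvg ip x w.
Proof.
move=> Bz.
have cluster (F : set_system nat) : UltraFilter F -> \oo `<=` F ->
    exists2 w, B w (- T w) & forall h, ip (x k) h @[k --> F] --> ip w h.
  move=> FF ooF.
  have [w xw] := bounded_ultra_weak_limit FF (fun k => fb_bounded k Bz).
  by exists w => //; exact: fb_weak_limit_zero ooF Bz xw.
(* A reference ultrafilter fixes the candidate [w]; every other one has to produce the same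
   limit. *)
have [F [FF ooF]] := ultraFilterLemma (eventually_filter).
have [w Bw xw] := cluster F FF ooF; exists w => // h.
apply: cvg_ultra => G GG ooG.
have [w' Bw' xw'] := cluster G GG ooG.
suff -> : w = w' by exact: xw'.
have [l xl] : exists l, ip (x k) (w - w') @[k --> \oo] --> (l : R).
  exists (2^-1 * (lim (`|x k - w'| ^+ 2 @[k --> \oo])
    - lim (`|x k - w| ^+ 2 @[k --> \oo]) + (ip w w - ip w' w'))).
  have -> : (fun k => ip (x k) (w - w')) = (fun k => 2^-1 *
      (`|x k - w'| ^+ 2 - `|x k - w| ^+ 2 + (ip w w - ip w' w'))).
    apply/funext => k; rewrite -!ip_norm !ipE (ipC w (x k)) (ipC w' (x k)).
    lra.
  apply: cvgMl_tmp; apply: cvgD; last exact: cvg_cst.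
  by apply: cvgB; exact: fb_dist_cvg.
(* Testing both limits against [w - w'] itself yields [|w - w'|^2 = l - l = 0]. *)
have lw : ip w (w - w') = l.
  by apply: norm_cvg_unique (xw _) _ => V /xl xV; exact: ooF.
have lw' : ip w' (w - w') = l.
  by apply: norm_cvg_unique (xw' _) _ => V /xl xV; exact: ooG.
apply/eqP; rewrite -subr_eq0 -normr_eq0 -sqrf_eq0 -ip_norm.
by rewrite ipDl ipNl lw lw' subrr.
Qed.

(** With [p = x k + d k], [phi |p - z|] is bounded by a pairing that tends to [0], since the values
    in [B p] converge strongly to [- T z]. *)
Lemma fb_uniform_cvg z : uniformly_monotone_on_bounded ip B ->
  B z (- T z) -> x @ \oo --> z.
Proof.
move=> B_unif Bz; have [M pM] := fb_backward_bounded Bz.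
(* The points [x k + d k] lie in the domain of [B], while the iterates [x k] may not. *)
pose C : set H := [set z] `|` range (fun k => x k + d k).
have C_dom : C `<=` op_dom B.
  move=> _ [->|[k _ <-]]; first by exists (- T z).
  by exists (- (gamma^-1 *: d k) - T (x k)); exact: d_step.
have C_bnd : bounded_set C.
  exists (Num.max `|z| M); split=> [|r /ltW Mr]; first exact: num_real.
  move=> _ [->|[k _ <-]] /=; apply: le_trans Mr.
    by rewrite le_max lexx.
  by rewrite le_max pM orbT.
have [phi [phi_mono phi_ge0 phi_eq0 phi_ip]] := B_unif C C_dom C_bnd.
have ip0 : ip (x k + d k - z) (- (gamma^-1 *: d k) - T (x k) - - T z)
    @[k --> \oo] --> (0 : R).
  apply: (@cvg_ip0_bounded _ _ _ _ (M + `|z|)).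
    by apply/subr_cvg0; exact: fb_backward_cvg.
  by move=> k; apply: le_trans (ler_normB _ _) _; rewrite lerD2r.
suff pz : x k + d k @[k --> \oo] --> z.
  have -> : x = (fun k => x k + d k - d k) by apply/funext => k; rewrite addrK.
  rewrite -[X in _ --> X]subr0; apply: cvgB => //.
  exact: fb_residual_cvg0 Bz.
apply/subr_cvg0/cvgr0Pnorm_lt => e e0.
have phie : 0 < phi e.
  rewrite lt_neqAle phi_ge0 ?ltW// andbT eq_sym; apply/eqP.
  by case: (phi_eq0 e (ltW e0)) => + _ => /[apply] /eqP; rewrite gt_eqF.
have [N _ ipN] := (cvgr0Pnorm_lt _).1 ip0 _ phie; exists N => // k /= /ipN /=.
(* A distance of at least [e] would keep the pairing above [phi e > 0]. *)
apply: contraTT; rewrite -!leNgt => ek.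
apply: le_trans (phi_mono _ _ (ltW e0) ek) _.
apply: le_trans (ler_norm _); apply: phi_ip => //; last exact: d_step.
  by right; exists k.
by left.
Qed.

End Iteration.
End ForwardBackward.
End RealHilbert.

Theorem corollary3p4 (R : realType) (H : completeNormedModType R)
  (ip : {dot H for idfun}) (ip_norm : induces_norm ip)
  (B : H -> set H) (B_max : maximally_monotone ip B)
  (T : H -> H) (beta : R) (beta_gt0 : 0 < beta)
  (T_coco : cocoercive ip beta T)
  (zer_neq0 : op_zer (op_add B (op_fun T)) !=set0)
  (gamma : R) (gamma_gt0 : 0 < gamma) (gamma_lt : gamma < 4 * beta)
  (lam : nat -> R)
  (lam_range : forall k, 0 < lam k /\ lam k <= 2 - gamma / (2 * beta))
  (lam_sum : (\sum_(0 <= k <oo)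
     (lam k * (2 - gamma / (2 * beta) - lam k))%:E)%E = +oo%E)
  (x0 : H) (x y : nat -> H) (x_init : x 0%N = x0)
  (y_def : forall k, y k = x k - gamma *: T (x k))
  (x_step : forall k, exists2 p : H, resolvent gamma B (y k) p &
     x k.+1 = x k + lam k *: (p - x k)) :
  exists xbar : H,
    [/\ op_zer (op_add B (op_fun T)) xbar,
        weakly_cvg ip x xbar,
        T (x k) @[k --> \oo] --> T xbar
      & unique (op_zer (dual_op B T)) (T xbar)] /\
    (uniformly_monotone_on_bounded ip B \/
       (forall z, op_zer (op_add B (op_fun T)) z -> demiregular_at ip T z) ->
     x k @[k --> \oo] --> xbar).
Proof.
have /choice[d d_step] : forall k, exists d : H,
    fb_step B T gamma (x k) d /\ x k.+1 = x k + lam k *: d.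
  move=> k; have [p /resolvent_graph pP xS] := x_step k.
  exists (p - x k); split=> //; rewrite /fb_step [x k + _]addrC subrK.
  have := pP (lt0r_neq0 gamma_gt0); rewrite y_def; congr (B p _).
  rewrite -addrA [- _ - p]addrC addrA scalerBr scalerA mulVf ?gt_eqF//.
  by rewrite scale1r -scalerN opprB.
have dP k := (d_step k).1; have xS k := (d_step k).2.
have [z /op_zer_addP Bz] := zer_neq0.
have [xbar Bxbar x_weak] := fb_weak_cvg ip_norm B_max beta_gt0 T_coco gamma_gt0
  lam_range lam_sum dP xS Bz.
(* The zero [w] is arbitrary here: uniqueness of limits makes [T] constant on the zeros, hence the
   dual solution unique. *)
have T_cvg w : B w (- T w) -> T (x k) @[k --> \oo] --> T w.
  exact: (fb_forward_cvg ip_norm B_max beta_gt0 T_coco gamma_gt0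
    lam_range lam_sum dP xS).
exists xbar; split.
  split; [exact/op_zer_addP|exact: x_weak|exact: T_cvg|split].
    by apply/op_zer_dualP; exists xbar => //; exact/op_zer_addP.
  move=> _ /op_zer_dualP[w /op_zer_addP Bw ->].
  exact: norm_cvg_unique (T_cvg _ Bxbar) (T_cvg _ Bw).
move=> [B_unif|T_demi].
  exact: (fb_uniform_cvg ip_norm B_max beta_gt0 T_coco gamma_gt0
    lam_range lam_sum dP xS).
by apply: T_demi => //; [exact/op_zer_addP|exact: T_cvg].
Qed.
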